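(* Let $T\ge1$, $n\ge1$ with $nT\ge2$, $\mu\in\mathbb{R}$, $\sigma>0$, $z^*\in\mathbb{R}$, $\tau\in\{1,\dots,T\}$. Under $\mathbf{H_0}$ the real numbers $X_{t,k}$ ($t\le T$, $k\le n$) are i.i.d. $\mathcal{N}(\mu,\sigma^2)$; under $\mathbf{H_1^\tau}$ they are generated the same way and then $X_{\tau,J}$ is replaced by $z^*$, with $J$ uniform on $\{1,\dots,n\}$ independent of the data. Let $\hat\mu_T=\frac{1}{nT}\sum_{t=1}^T\sum_{k=1}^nX_{t,k}$, $W=\hat\mu_T-\mu$, and \[ L_{\mathrm{FO}}=-\frac12\log\Big(\frac{nT-1}{nT}\Big)-\frac{nT}{2(nT-1)\sigma^2}W^2+\frac{nT(z^*-\mu)}{(nT-1)\sigma^2}W-\frac{(z^*-\mu)^2}{2(nT-1)\sigma^2}. \] Let $\beta_{\mathrm{FO}}(\gamma)=\mathbb{P}_{\mathbf{H_1^\tau}}(L_{\mathrm{FO}}<\gamma)$, $\gamma^{(T)}_{\max}=\frac12\big[\frac{(z^*-\mu)^2}{\sigma^2}-\log\big(\frac{nT-1}{nT}\big)\big]$, $m^*=\frac{(z^*-\mu)^2}{\sigma^2}$, $a_T=\sqrt{m^*nT}$, $b_T(\gamma)=\sqrt{(nT-1)\big(m^*-\log(1-\frac1{nT})-2\gamma\big)}$. Then for every $\gamma\le\gamma^{(T)}_{\max}$, \[ \beta_{\mathrm{FO}}(\gamma)=\Phi\Big(a_T\sqrt{\tfrac{nT-1}{nT}}-b_T(\gamma)\sqrt{\tfrac{nT}{nT-1}}\Big)+\Phi\Big(-a_T\sqrt{\tfrac{nT-1}{nT}}-b_T(\gamma)\sqrt{\tfrac{nT}{nT-1}}\Big),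 \] where $\Phi$ is the standard normal cumulative distribution function.
   Context: $L_{\mathrm{FO}}$ is the log likelihood ratio statistic of a membership test that only observes the final cumulative mean; $\beta_{\mathrm{FO}}(\gamma)$ is its Type II error at threshold $\gamma$. *)

(* Defs.v *)
From HB Require Import structures.
From mathcomp Require Import all_boot all_order all_algebra.
From mathcomp Require Import all_classical all_reals all_analysis.
Set Implicit Arguments. Unset Strict Implicit. Unset Printing Implicit Defensive.
Import Order.TTheory GRing.Theory Num.Theory.
Import numFieldNormedType.Exports.
Local Open Scope classical_set_scope.
Local Open Scope ring_scope.

Section defs.
Context {R : realType}.

Definition Phi (x : R) : \bar R := normal_prob 0 1 `]-oo, x].

(* Data under H1^tau: X_{tau,J} is replaced by z*.  Indices are 0-based:
   t : 'I_T stands for t+1 in {1..T}, k : 'I_n for k+1 in {1..n}. *)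
Definition dataH1 {Omega : Type} (T n : nat) (X : 'I_T -> 'I_n -> Omega -> R)
  (J : Omega -> 'I_n) (tau : 'I_T) (zs : R) (t : 'I_T) (k : 'I_n) (w : Omega) : R :=
  if (t == tau) && (k == J w) then zs else X t k w.

Definition muhat (T n : nat) (Y : 'I_T -> 'I_n -> R) : R :=
  (\sum_(t < T) \sum_(k < n) Y t k) / (n * T)%:R.

Definition L_FO (T n : nat) (mu sigma zs W : R) : R :=
  let N := (n * T)%:R in
  - 2^-1 * ln ((N - 1) / N)
  - N / (2 * (N - 1) * sigma ^+ 2) * W ^+ 2
  + N * (zs - mu) / ((N - 1) * sigma ^+ 2) * W
  - (zs - mu) ^+ 2 / (2 * (N - 1) * sigma ^+ 2).

Definition gamma_max (T n : nat) (mu sigma zs : R) : R :=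
  let N := (n * T)%:R in
  2^-1 * ((zs - mu) ^+ 2 / sigma ^+ 2 - ln ((N - 1) / N)).

Definition m_star (mu sigma zs : R) : R := (zs - mu) ^+ 2 / sigma ^+ 2.

Definition a_T (T n : nat) (mu sigma zs : R) : R :=
  Num.sqrt (m_star mu sigma zs * (n * T)%:R).

Definition b_T (T n : nat) (mu sigma zs gamma : R) : R :=
  let N := (n * T)%:R in
  Num.sqrt ((N - 1) * (m_star mu sigma zs - ln (1 - N^-1) - 2 * gamma)).

(* Mutual independence of the real random variables X t k (t < T, k < n)
   together with the 'I_n-valued random variable J: the joint probability of
   any family of events {X t k \in B t k} (B t k measurable) and {J \in C}
   is the product of the individual probabilities.  Taking some B t k = setT
   gives the product rule for every subfamily. *)
Definition mutually_independent d (Omega : measurableType d)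
  (P : probability Omega R) (T n : nat) (X : 'I_T -> 'I_n -> Omega -> R)
  (J : Omega -> 'I_n) : Prop :=
  forall (B : 'I_T -> 'I_n -> set R) (C : set 'I_n),
    (forall t k, measurable (B t k)) ->
    P [set w | (forall t k, B t k (X t k w)) /\ C (J w)] =
    ((\prod_(t < T) \prod_(k < n) fine (P (X t k @^-1` B t k)))
       * fine (P (J @^-1` C)))%:E.

End defs.

(* Main.v *)
Require Import Defs.
From HB Require Import structures.
From mathcomp Require Import all_boot all_order all_algebra.
From mathcomp Require Import all_classical all_reals all_analysis.
From mathcomp Require Import measurable_realfun ring lra.
Set Implicit Arguments. Unset Strict Implicit. Unset Printing Implicit Defensive.
Import Order.TTheory GRing.Theory Num.Theory.
Import numFieldNormedType.Exports.
Local Open Scope classical_set_scope.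
Local Open Scope ring_scope.

(** Write N = nT.  On the event J = j the statistic depends on the data only
    through the sum S of the N - 1 untouched observations, and completing the
    square in W turns L_FO < gamma into |S - (N - 1) z*| > b sigma sqrt N.
    By independence of J, S is N((N - 1) mu, (N - 1) sigma^2) conditionally on
    J = j, for every j, so the probability is the sum of two normal tails.
    These are Phi(e - c) and Phi(- e - c) with e = (z* - mu) sqrt(N - 1) / sigma
    and c = b sqrt(N / (N - 1)); their sum only depends on
    |e| = a sqrt((N - 1) / N).  The normal law of S is obtained one summand at
    a time, by Tonelli and by completing the square in the product of the two
    densities. *)

(** * Normal laws: affine changes of variable and convolution *)

Section normal_theory.
Context {R : realType}.
Implicit Types (m s a c x : R) (A : set R).
Local Notation mu := (@lebesgue_measure R).

Lemma measurable_EFin_normal_pdf m s (D : set R) :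
  measurable_fun D (fun x => (normal_pdf m s x)%:E).
Proof.
by apply/measurable_EFinP/measurable_funTS; exact: measurable_normal_pdf.
Qed.

(** The Radon-Nikodym derivative of the normal law and [normal_pdf] have equal integrals over every
    measurable set, hence agree almost everywhere. This turns an integral against the law into a
    Lebesgue integral, to which Tonelli can be applied. *)
Lemma integral_normal_prob m s (f : R -> \bar R) :
  (normal_prob m s).-integrable setT f ->
  (\int[normal_prob m s]_x f x = \int[mu]_x (f x * (normal_pdf m s x)%:E))%E.
Proof.
move=> intf; have mf := measurable_int _ intf.
have dom := normal_prob_dominates m s.
have mp := @measurable_EFin_normal_pdf m s setT.
rewrite -(Radon_Nikodym_change_of_variables dom measurableT intf).
have iRN := @Radon_Nikodym_integrable _ _ _
  (charge_of_finite_measure (normal_prob m s)) mu dom.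
apply: ae_eq_integral => //=.
- by apply: emeasurable_funM => //; exact: measurable_int iRN.
- exact: emeasurable_funM.
apply: ae_eqe_mul2l; apply: integral_ae_eq => //.
by move=> E _ mE; rewrite -Radon_Nikodym_integral.
Qed.

Lemma normal_pdf_affine m s a c x : 0 < s -> 0 < a ->
  normal_pdf m s (a * x + c) * a = normal_pdf ((m - c) / a) (s / a) x.
Proof.
move=> s0 a0; rewrite !normal_pdfE ?gt_eqF ?divr_gt0//.
rewrite mulrAC; congr (_ * _); last first.
  by congr expR; field; rewrite !gt_eqF.
rewrite /normal_peak.
have -> : (s / a) ^+ 2 * pi *+ 2 = (s ^+ 2 * pi *+ 2) / a ^+ 2 by field; rewrite gt_eqF.
rewrite sqrtrM ?mulrn_wge0 ?mulr_ge0 ?sqr_ge0 ?pi_ge0 ?ltW//.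
by rewrite sqrtrV ?sqr_ge0// sqrtr_sqr gtr0_norm// invfM invrK.
Qed.

Lemma normal_prob_affine_ray m s a c x : 0 < s -> 0 < a ->
  normal_prob m s `]-oo, a * x + c] = normal_prob ((m - c) / a) (s / a) `]-oo, x].
Proof.
move=> s0 a0; pose F (y : R^o) : R^o := a * y + c.
have F'E : F^`()%classic = cst a.
  apply/funext => y; rewrite /F derive1E deriveD// derive_cst addr0 deriveM//.
  by rewrite derive_id derive_cst scaler0 addr0 /GRing.scale/= mulr1.
rewrite /normal_prob -[a * x + c]/(F x).
rewrite (@increasing_ge0_integration_by_substitutionNy _ F (normal_pdf m s)).
- apply: eq_integral => y _; rewrite F'E !fctE; congr EFin.
  exact: normal_pdf_affine.
- by move=> y z _ _ yz; rewrite /F ltrD2r ltr_pM2l.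
- by rewrite F'E => ? _; exact: cst_continuous.
- by rewrite F'E; exact: is_cvg_cst.
- by rewrite F'E; exact: cvg_cst.
- split; first by move=> y _; rewrite /F; exact: derivableD.
  apply: cvg_at_left_filter; apply: cvgD; last exact: cvg_cst.
  by apply: cvgM; [exact: cvg_cst|exact: cvg_id].
- apply: (@cvg_comp _ _ _ (fun y : R => a * y) (fun y => y + c) _ -oo).
    by apply: gt0_cvgMrNy => //; exact: cvg_id.
  exact: cvg_addrr_Ny.
- by apply: continuous_subspaceT; apply: continuous_normal_pdf; rewrite gt_eqF.
- by move=> y _; exact: normal_pdf_ge0.
Qed.

(** The complements of these rays are the open right rays, which are stable under intersection,
    generate the Borel sets and exhaust the line. *)
Lemma eq_probability_rays (P Q : probability (measurableTypeR R) R) :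
  (forall x, P `]-oo, x]%classic = Q `]-oo, x]%classic) ->
  forall A, measurable A -> P A = Q A.
Proof.
move=> PQ A mA.
apply: (@measure_unique _ R (measurableTypeR R) (@RGenOInfty.G R)
  (fun n => `](- n%:R), +oo[%classic) _ _ _ _ P Q) => //=.
- exact: RGenOInfty.measurableE.
- move=> _ _ [x ->] [y ->]; exists (Num.max x y).
  apply/seteqP; split => z /=; rewrite !in_itv/= !andbT gt_max.
    by move=> [-> ->].
  by move=> /andP[].
- by move=> n; exists (- n%:R).
(* This integer exceeds |x|, so its opposite lies strictly below x. *)
- apply/seteqP; split => // x _; exists (Num.truncn `|x|).+1 => //=.
  rewrite in_itv/= andbT ltrNl (le_lt_trans _ (truncnS_gt _))//.
  by rewrite -normrN ler_norm.
- move=> _ [x ->]; rewrite -setCitvl.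
  by rewrite !probability_setC//; congr (_ - _)%E; exact: PQ.
- by move=> k; rewrite (le_lt_trans (probability_le1 _ _)) ?ltry.
Qed.

Lemma normal_prob_shift m s c A : 0 < s -> measurable A ->
  normal_prob m s [set y | A (c + y)] = normal_prob (m + c) s A.
Proof.
move=> s0 mA; have mc : @measurable_fun _ _ (measurableTypeR R) (measurableTypeR R)
    setT (fun y => c + y).
  exact: measurable_funD.
pose f : {mfun measurableTypeR R >-> measurableTypeR R} :=
  @mfun_Sub _ _ (measurableTypeR R) (measurableTypeR R) _ (mem_set mc).
have := @eq_probability_rays (distribution (normal_prob m s) f) (normal_prob (m + c) s).
rewrite /distribution/= /pushforward/=; apply => // x.
have -> : (fun y => c + y) @^-1` `]-oo, x] = `]-oo, (x - c)]%classic.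
  by apply/seteqP; split => y /=; rewrite !in_itv/= lerBrDl.
have := @normal_prob_affine_ray (m + c) s 1 c (x - c) s0 ltr01.
by rewrite mul1r subrK addrK !divr1 => ->.
Qed.

(** Completing the square in x. The left side is the joint density of a first summand x and a sum z;
    the right side is the density of the sum times the conditional density of the first summand
    given the sum. *)
Lemma normal_pdf_mul m1 m2 s1 s2 s x z : 0 < s1 -> 0 < s2 -> 0 < s ->
  s ^+ 2 = s1 ^+ 2 + s2 ^+ 2 ->
  normal_pdf (m2 + x) s2 z * normal_pdf m1 s1 x =
  normal_pdf (m1 + m2) s z *
  normal_pdf ((m1 * s2 ^+ 2 + (z - m2) * s1 ^+ 2) / s ^+ 2) (s1 * s2 / s) x.
Proof.
move=> s10 s20 s0 sE; rewrite !normal_pdfE ?gt_eqF ?divr_gt0 ?mulr_gt0//.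
rewrite mulrACA [RHS]mulrACA; congr (_ * _).
  rewrite /normal_peak -!invfM -!sqrtrM ?mulrn_wge0 ?mulr_ge0 ?sqr_ge0 ?pi_ge0 ?ltW//.
  by congr (Num.sqrt _)^-1; field; rewrite gt_eqF.
rewrite /normal_fun -!expRD; congr expR.
have s2E : (s1 * s2 / s) ^+ 2 = s1 ^+ 2 * s2 ^+ 2 / (s1 ^+ 2 + s2 ^+ 2).
  by rewrite -sE; field; rewrite gt_eqF.
rewrite s2E sE; field.
by rewrite !gt_eqF// ?addr_gt0 ?exprn_gt0.
Qed.

(** The section of the event at x is a translate of [A], so the product mass is a double integral of
    the joint density of x and the sum z, with z in [A]. After exchanging the integrals, the inner
    one is that of a normal density in x, which is 1. *)
Lemma normal_prob_conv m1 m2 s1 s2 s A : 0 < s1 -> 0 < s2 -> 0 < s ->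
  s ^+ 2 = s1 ^+ 2 + s2 ^+ 2 -> measurable A ->
  (normal_prob m1 s1 \x normal_prob m2 s2)%E [set xy | A (xy.1 + xy.2)] =
  normal_prob (m1 + m2) s A.
Proof.
move=> s10 s20 s0 sE mA.
have mD : measurable [set xy : R * R | A (xy.1 + xy.2)].
  rewrite -[X in measurable X]setTI.
  exact: (measurable_funD measurable_fst measurable_snd).
have secE x : normal_prob m2 s2 (xsection [set xy : R * R | A (xy.1 + xy.2)] x) =
    normal_prob (m2 + x) s2 A.
  rewrite -normal_prob_shift//; congr (normal_prob _ _ _).
  by apply/seteqP; split => y; rewrite /xsection/= inE.
have msec := measurable_fun_xsection (normal_prob m2 s2) mD.
rewrite /product_measure1 integral_normal_prob; last first.
  apply: (@le_integrable _ _ _ _ _ measurableT _ (EFin \o cst 1)) => //; last first.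
    exact: finite_measure_integrable_cst.
  move=> x _ /=; rewrite normr1 gee0_abs// probability_le1//.
  exact: measurable_xsection.
under eq_integral do rewrite /= secE.
rewrite /normal_prob.
pose f (xz : R * R) : \bar R :=
  (normal_pdf (m2 + xz.1) s2 xz.2 * normal_pdf m1 s1 xz.1 * \1_A xz.2)%:E.
have mf : measurable_fun [set: R * R] f.
  (* Moving x from the mean to the argument shows the density to be jointly measurable in (x, z). *)
  have pE x z : normal_pdf (m2 + x) s2 z = normal_pdf m2 s2 (z - x).
    rewrite !normal_pdfE ?gt_eqF//; congr (_ * expR _).
    by rewrite opprD addrA addrAC.
  apply/measurable_EFinP; apply: measurable_funM.
    apply: measurable_funM.
      under eq_fun do rewrite pE.
      apply: measurableT_comp; first exact: measurable_normal_pdf.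
      exact: measurable_funB measurable_snd measurable_fst.
    by apply: measurableT_comp; first exact: measurable_normal_pdf.
  by apply: measurableT_comp => //; exact: measurable_indic.
have f0 xz : (0 <= f xz)%E by rewrite lee_fin !mulr_ge0 ?normal_pdf_ge0.
transitivity (\int[mu]_x \int[mu]_z f (x, z))%E.
  apply: eq_integral => x _; rewrite -ge0_integralZr//; last 3 first.
  - exact: measurable_EFin_normal_pdf.
  - by move=> z _; rewrite lee_fin normal_pdf_ge0.
  - by rewrite lee_fin normal_pdf_ge0.
  rewrite integral_mkcond; apply: eq_integral => z _.
  by rewrite /f/= patchE indicE; case: ifP => _; rewrite ?mulr1 ?mulr0.
transitivity (\int[mu]_z \int[mu]_x f (x, z))%E.
  exact: (@fubini_tonelli _ _ _ _ R mu mu f mf f0).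
rewrite [RHS]integral_mkcond; apply: eq_integral => z _.
rewrite /f/= patchE indicE; case: ifP => _; last first.
  by under eq_integral do rewrite mulr0; exact: integral0.
under eq_integral do rewrite mulr1 (normal_pdf_mul _ _ _ _ s10 s20 s0 sE) EFinM.
rewrite ge0_integralZl//=; last 3 first.
- exact: measurable_EFin_normal_pdf.
- by move=> x _; rewrite lee_fin normal_pdf_ge0.
- by rewrite lee_fin normal_pdf_ge0.
by rewrite integral_normal_pdf mule1.
Qed.

End normal_theory.

(** * Sums of independent normal variables *)

Section sum_of_normals.
Context {R : realType} d (Omega : measurableType d).

(** Values on rectangles determine a product measure, so the law of (f, g) under [Q] is [c] times
    the product of the two normal laws. The total mass [c] is left free so that [Q] can be a
    probability restricted to an event. *)
Lemma measure_add_normal (Q : {measure set Omega -> \bar R}) (f g : Omega -> R)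
    (c m1 m2 s1 s2 s : R) :
  measurable_fun setT f -> measurable_fun setT g ->
  0 <= c -> 0 < s1 -> 0 < s2 -> 0 < s -> s ^+ 2 = s1 ^+ 2 + s2 ^+ 2 ->
  (forall A B, measurable A -> measurable B ->
    Q (f @^-1` A `&` g @^-1` B) = c%:E * (normal_prob m1 s1 A * normal_prob m2 s2 B))%E ->
  forall A, measurable A ->
    Q [set w | A (f w + g w)] = (c%:E * normal_prob (m1 + m2) s A)%E.
Proof.
move=> mf mg c0 s10 s20 s0 sE QE A mA.
pose fg (w : Omega) : measurableTypeR R * measurableTypeR R := (f w, g w).
have mfg : measurable_fun setT fg by exact: measurable_fun_pair.
(* The general case divides by [c]. If [c] is 0, the hypothesis on the full rectangle says that [Q]
   has total mass 0. *)
have [c00|cn0] := eqVneq c 0.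
  rewrite c00 mul0e; apply/eqP; rewrite eq_le measure_ge0 andbT.
  have := QE setT setT measurableT measurableT.
  rewrite !preimage_setT setTI c00 mul0e => <-.
  apply: le_measure; rewrite ?inE//.
  rewrite -[X in measurable X]setTI.
  exact: measurable_funD.
have mD : measurable [set xy : measurableTypeR R * measurableTypeR R | A (xy.1 + xy.2)].
  rewrite -[X in measurable X]setTI.
  exact: (measurable_funD measurable_fst measurable_snd).
rewrite -(normal_prob_conv m1 m2 s10 s20 s0 sE mA).
have ci0 : 0 <= c^-1 by rewrite invr_ge0.
pose Q' : {measure set _ -> \bar R} := pushforward Q fg.
rewrite (@product_measure_unique _ _ _ _ R (normal_prob m1 s1) (normal_prob m2 s2)
  (mscale (NngNum ci0) (Q' mfg))) => //.
  by rewrite /mscale/= muleA -EFinM mulfV// mul1e.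
move=> B C mB mC; transitivity (c^-1%:E * Q (f @^-1` B `&` g @^-1` C))%E => //.
by rewrite QE// muleA -EFinM mulVf// mul1e.
Qed.

(* The events [B i] outside [r] make the induction on [r] go through: the next
   summand is one of the variables they constrain. *)
Lemma sum_iid_normal (P : probability Omega R) (I : finType)
    (Y : I -> Omega -> R) (m s q : R) (E : set Omega) :
  0 < s -> 0 <= q -> measurable E ->
  (forall i, measurable_fun setT (Y i)) ->
  (forall B : I -> set R, (forall i, measurable (B i)) ->
    P [set w | (forall i, B i (Y i w)) /\ E w] =
    (\prod_i fine (normal_prob m s (B i)) * q)%:E) ->
  forall r : seq I, uniq r -> (0 < size r)%N ->
  forall (B : I -> set R) (A : set R), (forall i, measurable (B i)) -> measurable A ->
  P [set w | A (\sum_(i <- r) Y i w) /\ (forall i, i \notin r -> B i (Y i w)) /\ E w] =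
  ((\prod_(i | i \notin r) fine (normal_prob m s (B i)) * q)%:E *
   normal_prob ((size r)%:R * m) (s * Num.sqrt (size r)%:R) A)%E.
Proof.
move=> s0 q0 mE mY YE; elim=> [//|i0 r IH] /= /andP[i0r ur] _ B A mB mA.
have finN B' : measurable B' -> normal_prob m s B' \is a fin_num.
  by move=> mB'; rewrite fin_num_measure.
have mB' (B0 : set R) : measurable B0 ->
    forall i, measurable (if i == i0 then B0 else B i).
  by move=> mB0 i; case: ifP.
have prodB (B0 : set R) (p : pred I) : ~~ p i0 ->
    \prod_(i | p i) fine (normal_prob m s (if i == i0 then B0 else B i)) =
    \prod_(i | p i) fine (normal_prob m s (B i)).
  move=> pi0; apply: eq_bigr => i pi.
  by case: eqP => // ii0; rewrite ii0 (negbTE pi0) in pi.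
(* The induction starts at one summand, since zero summands would give a normal law of zero
   deviation. For a single summand, the condition [A] becomes the constraint at index [i0]. *)
have [r0|r0] := posnP (size r).
  move: (size0nil r0) => ->; rewrite /= sqrtr1 mulr1 mul1r.
  transitivity (P [set w | (forall i, (if i == i0 then A else B i) (Y i w)) /\ E w]).
    congr (P _); apply/seteqP; split => w /=; rewrite big_seq1.
      move=> [Aw [Bw Ew]]; split => // i; case: eqP => [->//|/eqP ii0].
      by apply: Bw; rewrite inE.
    move=> [Bw Ew]; split; first by have := Bw i0; rewrite eqxx.
    split => // i; rewrite inE => /negbTE ii0.
    by have := Bw i; rewrite ii0.
  rewrite (YE (fun i => if i == i0 then A else B i)); last exact: mB'.
  rewrite (bigD1 i0)//= eqxx -mulrA EFinM fineK ?finN// muleC.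
  congr (_%:E * _)%E; congr (_ * _).
  under [in RHS]eq_bigl do rewrite inE.
  by rewrite prodB ?eqxx.
(* The constraints outside [i0 :: r] are absorbed into one event. Under [P] restricted to it, the
   partial sum over [r] and [Y i0] satisfy the rectangle formula of [measure_add_normal]. *)
pose E' := [set w | (forall i, i \notin i0 :: r -> B i (Y i w)) /\ E w].
have mE' : measurable E'.
  suff : measurable (\bigcap_(i in [set i | i \notin i0 :: r]) Y i @^-1` B i `&` E) by [].
  apply: measurableI => //; apply: fin_bigcap_measurable => [|i _].
    exact: finite_finset.
  by rewrite -[X in measurable X]setTI; exact: mY.
under eq_set do rewrite big_cons addrC.
have := @measure_add_normal (mrestr P mE') (fun w => \sum_(i <- r) Y i w) (Y i0)
  (\prod_(i | i \notin i0 :: r) fine (normal_prob m s (B i)) * q)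
  ((size r)%:R * m) m (s * Num.sqrt (size r)%:R) s (s * Num.sqrt (size r).+1%:R).
have -> : (size r)%:R * m + m = (size r).+1%:R * m by rewrite -natr1 mulrDl mul1r.
rewrite /mrestr/=.
have -> : [set w | A (\sum_(i <- r) Y i w + Y i0 w) /\
   (forall i, i \notin i0 :: r -> B i (Y i w)) /\ E w] =
   [set w | A (\sum_(i <- r) Y i w + Y i0 w)] `&` E' by [].
apply => //.
- exact: measurable_sum.
- by rewrite mulr_ge0// prodr_ge0// => i _; rewrite fine_ge0.
- by rewrite mulr_gt0// sqrtr_gt0 ltr0n.
- by rewrite mulr_gt0// sqrtr_gt0 ltr0n.
- by rewrite !exprMn !sqr_sqrtr// -natr1 mulrDr mulr1.
move=> A' B0 mA' mB0.
(* As [i0] is not in [r], the induction hypothesis may constrain [Y i0] to [B0]; its factor at [i0]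
   is then the normal mass of [B0]. *)
have := IH ur r0 (fun i => if i == i0 then B0 else B i) A' (mB' _ mB0) mA'.
have -> : [set w | A' (\sum_(i <- r) Y i w) /\ (forall i, i \notin r ->
    (if i == i0 then B0 else B i) (Y i w)) /\ E w] =
    (fun w => \sum_(i <- r) Y i w) @^-1` A' `&` Y i0 @^-1` B0 `&` E'.
  apply/seteqP; split => w /=.
    move=> [Aw [Bw Ew]]; split; first by split => //; have := Bw i0 i0r; rewrite eqxx.
    split => // i; rewrite inE negb_or => /andP[/negbTE ii0 ir].
    by have := Bw i ir; rewrite ii0.
  move=> [[Aw B0w] [Bw Ew]]; split => //; split => // i ir.
  by case: eqP => [->//|/eqP ii0]; apply: Bw; rewrite inE negb_or ii0.
move=> IHE; apply: (eq_trans IHE); rewrite (bigD1 i0)//= eqxx.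
under eq_bigl => i do rewrite andbC -negb_or -in_cons.
rewrite prodB ?inE ?eqxx// -mulrA EFinM fineK ?finN//.
by rewrite [LHS]muleC [LHS]muleA [LHS]muleC.
Qed.

End sum_of_normals.

(** * Normal tails expressed through [Phi] *)

Section normal_tails.
Context {R : realType}.
Implicit Types m s x : R.

Lemma normal_prob_lray m s x : 0 < s ->
  normal_prob m s `]-oo, x] = Phi ((x - m) / s).
Proof.
move=> s0; have s_neq0 : s != 0 by rewrite gt_eqF.
have [e0 e1] : (m - m) / s = 0 /\ s / s = 1 by split; field.
have e2 : s * ((x - m) / s) + m = x by field.
have := @normal_prob_affine_ray _ m s s m ((x - m) / s) s0 s0.
by rewrite e2 e0 e1.
Qed.

Lemma normal_prob_lray_open m s x : 0 < s ->
  normal_prob m s `]-oo, x[ = Phi ((x - m) / s).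
Proof.
move=> s0; rewrite -normal_prob_lray// /normal_prob.
by apply: integral_itv_bndo_bndc; exact: measurable_EFin_normal_pdf.
Qed.

Lemma Phi_opp x : Phi (- x) = normal_prob 0 1 `]x, +oo[.
Proof.
rewrite /Phi /normal_prob ge0_integration_by_substitutionNy; last 2 first.
- by apply: continuous_subspaceT; apply: continuous_normal_pdf; rewrite oner_eq0.
- by move=> y _; exact: normal_pdf_ge0.
rewrite integral_itv_obnd_cbnd; last exact: measurable_EFin_normal_pdf.
apply: eq_integral => y _ /=.
by rewrite !normal_pdfE ?oner_eq0// /normal_fun !subr0 sqrrN.
Qed.

Lemma normal_prob_rray m s x : 0 < s ->
  normal_prob m s `]x, +oo[ = Phi (- ((x - m) / s)).
Proof.
have rrayE m' s' x' :
    normal_prob m' s' `]x', +oo[ = (1 - normal_prob m' s' `]-oo, x'])%E.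
  by rewrite -setCitvl probability_setC.
by move=> s0; rewrite Phi_opp !rrayE normal_prob_lray.
Qed.

(** The condition [lo <= hi] makes the two open rays disjoint, so their masses add. *)
Lemma normal_prob_two_tails m s lo hi : 0 < s -> lo <= hi ->
  normal_prob m s [set y | y < lo \/ hi < y] =
  (Phi ((lo - m) / s) + Phi (- ((hi - m) / s)))%E.
Proof.
move=> s0 lohi; rewrite -normal_prob_lray_open// -normal_prob_rray//.
rewrite -measureU//.
  congr (normal_prob _ _ _).
  by apply/seteqP; split => y /=; rewrite !in_itv/= andbT.
apply/seteqP; split => // y /=; rewrite !in_itv/= andbT => -[ylo hiy].
by have := lt_trans ylo (le_lt_trans lohi hiy); rewrite ltxx.
Qed.

End normal_tails.

(** * The rejection threshold in terms of the untouched observations *)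

Section threshold.
Context {R : realType}.

(** With D = S - (N - 1) z*, [L_FO] minus [gamma] is a positive multiple of r^2 - D^2, so the event
    is |D| > r. The bound by [gamma_max] makes the radicand of [b_T] nonnegative; otherwise
    [Num.sqrt] would return 0 and r^2 would not recover it. *)
Lemma L_FO_lt (T n : nat) (mu sigma zs gamma S : R) : (2 <= n * T)%N -> 0 < sigma ->
  gamma <= gamma_max T n mu sigma zs ->
  let N : R := (n * T)%:R in
  let r := b_T T n mu sigma zs gamma * sigma * Num.sqrt N in
  (L_FO T n mu sigma zs ((S + zs) / N - mu) < gamma) <->
  (S < (N - 1) * zs - r \/ (N - 1) * zs + r < S).
Proof.
move=> N2 s0 gle N r.
have N1 : 1 < N by rewrite /N ltr1n.
have N0 : 0 < N by lra.
have lnE : ln ((N - 1) / N) = ln (1 - N^-1) by rewrite mulrBl divff ?mul1r ?gt_eqF.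
pose bb := (N - 1) * (m_star mu sigma zs - ln (1 - N^-1) - 2 * gamma).
have bb0 : 0 <= bb.
  rewrite mulr_ge0//; first by rewrite subr_ge0 ltW.
  by move: gle; rewrite /gamma_max /m_star -/N lnE; lra.
have r0 : 0 <= r by rewrite !mulr_ge0 ?sqrtr_ge0 ?ltW.
have r2 : r ^+ 2 = bb * sigma ^+ 2 * N.
  by rewrite /r !exprMn /b_T -/N -/bb !sqr_sqrtr// ltW.
pose D := S - (N - 1) * zs.
have -> : (L_FO T n mu sigma zs ((S + zs) / N - mu) < gamma) = (r ^+ 2 < D ^+ 2).
  rewrite r2 -subr_lt0 -[RHS]subr_lt0.
  have -> : L_FO T n mu sigma zs ((S + zs) / N - mu) - gamma =
    (bb * sigma ^+ 2 * N - D ^+ 2) / (2 * N * (N - 1) * sigma ^+ 2).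
    rewrite /L_FO -/N lnE /bb /D /m_star.
    by clear -s0 N1 N0; clearbody N; field; rewrite !gt_eqF// subr_gt0.
  by rewrite pmulr_llt0// invr_gt0 !mulr_gt0 ?exprn_gt0// subr_gt0.
rewrite -(ger0_norm r0) -(real_normK (num_real D)) ger0_norm//.
rewrite ltr_pXn2r ?nnegrE// ltr_normr; split.
  by move=> /orP[h|h]; [right|left]; move: h; rewrite /D; lra.
by move=> [h|h]; apply/orP; [right|left]; move: h; rewrite /D; lra.
Qed.

Lemma sum_dataH1 (Omega : Type) (T n : nat) (X : 'I_T -> 'I_n -> Omega -> R)
    (J : Omega -> 'I_n) (tau : 'I_T) (zs : R) (w : Omega) :
  \sum_(t < T) \sum_(k < n) dataH1 X J tau zs t k w =
  \sum_(i <- enum (predC1 (tau, J w))) X i.1 i.2 w + zs.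
Proof.
rewrite pair_bigA/= (bigD1 (tau, J w))//= /dataH1 !eqxx/= addrC; congr (_ + _).
rewrite big_enum/=; apply: eq_bigr => -[t k] /=.
by rewrite xpair_eqE => /negbTE ->.
Qed.

End threshold.

(** * Conditioning on the replaced position, and the error formula *)

Lemma probability_finite_partition (R : realType) d (Omega : measurableType d)
    (P : probability Omega R) (n : nat) (J : Omega -> 'I_n) (A : set Omega) :
  (forall j, measurable (A `&` J @^-1` [set j])) ->
  P A = (\sum_(j < n) P (A `&` J @^-1` [set j]))%E.
Proof.
move=> mAJ; rewrite -(measure_bigsetU_ord _ xpredT)//; last first.
  by move=> i j _ _ [w [[_ /= <-] [_ /= <-]]].
congr (P _); rewrite -bigcup_seq; apply/seteqP; split => w.
  by move=> Aw; exists (J w); rewrite /= ?mem_index_enum.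
by move=> [j _ []].
Qed.

Theorem lemma3p8 (R : realType) (d : measure_display) (Omega : measurableType d)
  (P : probability Omega R) (T n : nat) (mu sigma zs gamma : R) (tau : 'I_T)
  (X : 'I_T -> 'I_n -> {RV P >-> R}) (J : Omega -> 'I_n) :
  (1 <= T)%N -> (1 <= n)%N -> (2 <= n * T)%N -> 0 < sigma ->
  (* each X t k ~ N(mu, sigma^2) *)
  (forall t k A, measurable A -> distribution P (X t k) A = normal_prob mu sigma A) ->
  (* J is a random variable, uniform on {1..n} *)
  (forall j, measurable (J @^-1` [set j])) ->
  (forall j, P (J @^-1` [set j]) = (n%:R^-1)%:E) ->
  (* the X t k and J are mutually independent *)
  mutually_independent P (fun t k => (X t k : Omega -> R)) J ->
  gamma <= gamma_max T n mu sigma zs ->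
  let N : R := (n * T)%:R in
  P [set w | L_FO T n mu sigma zs
               (muhat (fun t k => dataH1 (fun t k => (X t k : Omega -> R)) J tau zs t k w)
                - mu) < gamma]
  = (Phi (a_T T n mu sigma zs * Num.sqrt ((N - 1) / N)
          - b_T T n mu sigma zs gamma * Num.sqrt (N / (N - 1)))
     + Phi (- a_T T n mu sigma zs * Num.sqrt ((N - 1) / N)
          - b_T T n mu sigma zs gamma * Num.sqrt (N / (N - 1))))%E.
Proof.
move=> T1 n1 N2 s0 XN mJ PJ indep gle N.
set b := b_T T n mu sigma zs gamma; set a := a_T T n mu sigma zs.
have N1 : 1 < N by rewrite /N ltr1n.
have N0 : 0 < N by rewrite (lt_trans ltr01).
have NB0 : 0 < N - 1 by rewrite subr_gt0.
pose r := b * sigma * Num.sqrt N.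
have r0 : 0 <= r by rewrite !mulr_ge0 ?sqrtr_ge0 ?ltW.
pose tails : set R := [set y | y < (N - 1) * zs - r \/ (N - 1) * zs + r < y].
have mtails : measurable tails.
  rewrite (_ : tails = `]-oo, (N - 1) * zs - r[ `|` `](N - 1) * zs + r, +oo[).
    exact: measurableU.
  by apply/seteqP; split => y /=; rewrite !in_itv/= andbT.
set ev := [set w | _].
pose S j w := \sum_(i <- enum (predC1 (tau, j))) X i.1 i.2 w.
(* Once [J] is fixed to j, the random set of untouched positions becomes deterministic, and the sum
   over it is [S j]. *)
have evE j : ev `&` J @^-1` [set j] = S j @^-1` tails `&` J @^-1` [set j].
  apply/seteqP; split => w [+ /= Jj]; rewrite /ev /muhat /= sum_dataH1 Jj;
  by move=> /(L_FO_lt _ N2 s0 gle).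
have mS j : measurable_fun setT (S j) by apply: measurable_sum => i.
have mev j : measurable (ev `&` J @^-1` [set j]).
  by rewrite evE; apply: measurableI => //; rewrite -[X in measurable X]setTI; exact: mS.
have size_enum (j : 'I_n) : size (enum (predC1 (tau, j))) = (n * T).-1.
  by rewrite -cardE cardC1 card_prod !card_ord mulnC.
have sizeE : (n * T).-1%:R = N - 1 :> R.
  by rewrite /N -[in RHS](prednK (ltnW N2)) -natr1 addrK.
have SJ j : P (ev `&` J @^-1` [set j]) =
    ((n%:R^-1)%:E * normal_prob ((N - 1) * mu) (sigma * Num.sqrt (N - 1)) tails)%E.
  rewrite evE -sizeE -(size_enum j).
  have q0 : 0 <= n%:R^-1 :> R by rewrite invr_ge0.
  (* Independence is recast with a single index ranging over pairs, the form required by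
     [sum_iid_normal]. *)
  have YE (B : 'I_T * 'I_n -> set R) : (forall i, measurable (B i)) ->
      P [set w | (forall i, B i (X i.1 i.2 w)) /\ (J @^-1` [set j]) w] =
      (\prod_i fine (normal_prob mu sigma (B i)) * n%:R^-1)%:E.
    move=> mB; transitivity (P [set w | (forall t k, B (t, k) (X t k w)) /\ [set j] (J w)]).
      congr (P _); apply/seteqP; split => w [Bw Jw]; split => //.
      by move=> [t k]; exact: Bw.
    rewrite (indep (fun t k => B (t, k)) [set j] (fun t k => mB (t, k))) PJ/=.
    congr (_ * _)%:E; rewrite pair_bigA/=; apply: eq_bigr => -[t k] _ /=.
    by rewrite -(XN t k _ (mB (t, k))).
  have mX i : measurable_fun setT (fun w => X i.1 i.2 w) by [].
  have s_gt0 : (0 < size (enum (predC1 (tau, j))))%N.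
    by rewrite size_enum -subn1 subn_gt0.
  (* The only position outside the sum, (tau, j), is left unconstrained by taking the whole line,
     which contributes a factor 1. *)
  have := sum_iid_normal s0 q0 (mJ j) mX YE (enum_uniq _) s_gt0
    (fun=> measurableT) mtails.
  rewrite big1 ?mul1r => [sumE|i _]; last by rewrite probability_setT.
  rewrite -sumE; congr (P _).
  by apply/seteqP; split => w /= => [[? ?]|[? []]].
rewrite (probability_finite_partition _ mev).
(* The normal mass does not depend on j, so the n weights 1/n add up to 1. *)
under eq_bigr do rewrite SJ.
rewrite -ge0_sume_distrl//.
rewrite sumEFin sumr_const card_ord -[n%:R^-1 *+ n]mulr_natr.
rewrite mulVf ?pnatr_eq0 -?lt0n// mul1e.
rewrite normal_prob_two_tails; last 2 first.
- by rewrite mulr_gt0// sqrtr_gt0.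
- by rewrite (le_trans (y := (N - 1) * zs))// ?lerDl// gerBl.
set q := Num.sqrt (N - 1).
have q2 : N - 1 = q ^+ 2 by rewrite sqr_sqrtr// ltW.
have q_neq0 : q != 0 by rewrite gt_eqF// sqrtr_gt0.
have s_neq0 : sigma != 0 by rewrite gt_eqF.
have sqrtNq : Num.sqrt (N / (N - 1)) = Num.sqrt N / q.
  by rewrite sqrtrM ?ltW// sqrtrV// ltW.
pose e := (zs - mu) * q / sigma.
have -> : ((N - 1) * zs - r - (N - 1) * mu) / (sigma * q) =
    e - b * Num.sqrt (N / (N - 1)).
  by rewrite sqrtNq q2 /e /r; field; rewrite q_neq0.
have -> : - (((N - 1) * zs + r - (N - 1) * mu) / (sigma * q)) =
    - e - b * Num.sqrt (N / (N - 1)).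
  by rewrite sqrtNq q2 /e /r; field; rewrite q_neq0.
(* Being a square root, [a] loses the sign of z* - mu, hence the absolute value. *)
have aE : a * Num.sqrt ((N - 1) / N) = `|e|.
  rewrite /a /a_T /m_star -/N -sqrtrM; last first.
    exact: mulr_ge0 (divr_ge0 (sqr_ge0 _) (sqr_ge0 _)) (ltW N0).
  rewrite -sqrtr_sqr; congr Num.sqrt.
  have N_neq0 : N != 0 by rewrite gt_eqF.
  by rewrite q2 /e; clearbody q; clear -N_neq0 s_neq0; clearbody N; field; rewrite s_neq0.
(* Changing the sign of e only swaps the two summands. *)
rewrite mulNr aE; have [e0|e0] := leP 0 e; first by rewrite ger0_norm.
by rewrite ltr0_norm// opprK addeC.
Qed.
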